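(* Let $n\in\mathbb{N}$, $n\ge1$, $N\in\mathbb{N}$, and let $$\mathcal{L}^n=\mathcal{Q}_n-\sum_{i=1}^N\Big(\frac{a_i}{p_i}+\frac{a_i}{p-p_i}\Big),\qquad \mathcal{Q}_n=(\mathcal{L}^n)_{\ge 1},$$ be the $n$-th power of a Sato function $\mathcal{L}=p+\sum_{j\ge0}V_j(T)p^{-j}$, where $a_i=a_i(T)$, $p_i=p_i(T)$. Put $\mathcal{Q}_k=[(\mathcal{L}^n)^{k/n}]_{\ge 1}$. Suppose that the constrained dispersionless mKP hierarchy holds: for all $k\in\mathbb{N}$ and $i=1,\dots,N$, $$(\mathcal{L}^n)_{T_k}=\{\mathcal{Q}_k,\mathcal{L}^n\},\qquad a_{i,T_k}=\Big[a_i\Big(\tfrac{\partial}{\partial p}\mathcal{Q}_k(p)\Big)\Big|_{p=p_i}\Big]_X,\qquad p_{i,T_k}=\big[\mathcal{Q}_k(p)|_{p=p_i}\big]_X .$$ Let $\phi=\phi(T)$ be a function satisfying $$\phi_{T_k}=\mathcal{Q}_k|_{p=\phi_X}\quad\text{for all }k\in\mathbb{N},\qquad \mathcal{Q}_n|_{p=\phi_X}-\sum_{i=1}^N\Big(\frac{a_i}{\phi_X-p_i}+\frac{a_i}{p_i}\Big)=0 .$$ Define $\tilde{\mathcal{L}}^n:=e^{-ad\phi}(\mathcal{L}^n)$, $\tilde a_i:=a_i$, $\tilde p_i:=p_i-\phi_X$ $(i=1,\dots,N)$. Then $$\tilde{\mathcal{L}}^n=\tilde{\mathcal{Q}}_n-\sum_{i=1}^N\Big(\frac{\tilde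 a_i}{\tilde p_i}+\frac{\tilde a_i}{p-\tilde p_i}\Big),\qquad \tilde{\mathcal{Q}}_n=(\tilde{\mathcal{L}}^n)_{\ge 1},$$ and, with $\tilde{\mathcal{Q}}_k=[(\tilde{\mathcal{L}}^n)^{k/n}]_{\ge 1}$, the constrained dispersionless mKP hierarchy also holds for the transformed data: for all $k\in\mathbb{N}$ and $i=1,\dots,N$, $$(\tilde{\mathcal{L}}^n)_{T_k}=\{\tilde{\mathcal{Q}}_k,\tilde{\mathcal{L}}^n\},\qquad \tilde a_{i,T_k}=\Big[\tilde a_i\Big(\tfrac{\partial}{\partial p}\tilde{\mathcal{Q}}_k(p)\Big)\Big|_{p=\tilde p_i}\Big]_X,\qquad \tilde p_{i,T_k}=\big[\tilde{\mathcal{Q}}_k(p)|_{p=\tilde p_i}\big]_X .$$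
   Context: $T=(T_1=X,T_2,T_3,\dots)$ are independent variables and all coefficient functions ($V_j,a_i,p_i,\phi$, etc.) are smooth functions of $T$; $p$ is a formal variable independent of $T$. All symbols such as $\mathcal{L},\tilde{\mathcal{L}}$ are formal Laurent series in $p^{-1}$ (finitely many positive powers of $p$) with coefficients functions of $T$; fractions $\frac{1}{p-\beta}$ are expanded as $\sum_{j\ge0}\beta^j p^{-j-1}$. Subscripts $T_k$, $X$ on a Laurent series denote coefficientwise partial derivatives with $p$ held fixed; subscripts on functions of $T$ denote partial derivatives, and $[\,\cdot\,]_X$ applied to an expression evaluated at $p=$ a function of $T$ is the derivative in $X$ of the resulting function of $T$. For $A=\sum_j c_jp^j$, $A_{\ge r}=\sum_{j\ge r}c_jp^j$. The Poisson bracket is $\{A,B\}=\frac{\partial A}{\partial p}\frac{\partial B}{\partial X}-\frac{\partial A}{\partial X}\frac{\partial B}{\partial p}$. For a series $M=p^n+\text{(lower powers of }p)$, $M^{1/n}$ is the unique series of the form $p+\text{(lower powers)}$ whose $n$-th power is $M$, and $M^{k/n}=(M^{1/n})^k$. The notation $\tilde{\mathcal{L}}^n$ denotes a series of the form $p^n+\text{lower}$, understood as the $n$-th power of $\tilde{\mathcal{L}}=(\tilde{\mathcal{L}}^n)^{1/n}$. For a function $\phi(T)$ and a series $\mu(p,T)$, $$e^{-ad\phi}(\mu)=\mu-\{\phi,\mu\}+\tfrac1{2!}\{\phi,\{\phi,\mu\}\}-\tfrac{1}{3!}\{\phi,\{\phi,\{\phi,\mu\}\}\}+\cdots=\sum_{l=0}^\infty\frac{1}{l!}(\phi_X)^l\,\partial_p^l\mu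 .$$ Convention: all denominators occurring that are functions of $T$ (here $p_i$ and $\phi_X-p_i=-\tilde p_i$) are nowhere zero. *)

(* Defs.v *)
From HB Require Import structures.
From mathcomp Require Import all_boot all_order all_algebra.
From mathcomp Require Import all_classical all_reals all_analysis.
Set Implicit Arguments.
Unset Strict Implicit.
Unset Printing Implicit Defensive.
Import Order.TTheory GRing.Theory Num.Theory.
Import numFieldNormedType.Exports.
Local Open Scope classical_set_scope.
Local Open Scope ring_scope.

(* Coordinate [j] of a point [t : nat -> R] is the variable T_(j+1); in
   particular X = T_1 is coordinate 0. *)
Notation timefun R := ((nat -> R) -> R) (only parsing).

(* Formal series in p: [A j] is the coefficient of p^j.  Only series whose
   coefficients vanish for large [j] (Laurent series in p^-1) are meaningful.
   The pointwise ring structure that the library puts on function types is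
   used for sums and differences of series and for all operations on
   coefficients; the product of two series is [lmul], NOT [*]. *)
Notation lseries R := (int -> (nat -> R) -> R) (only parsing).

Section Definitions.
Variable R : realType.
Implicit Types (t : nat -> R) (f g : timefun R) (A B M : lseries R).

Definition upd t (j : nat) (x : R) : nat -> R :=
  fun i => if i == j then x else t i.

Definition partial (j : nat) f : timefun R :=
  fun t => derive1 (fun x => f (upd t j x)) (t j).

Definition dT (k : nat) f : timefun R := partial k.-1 f.
Definition dX f : timefun R := dT 1 f.

Definition upd_first t (m : nat) (v : 'rV[R]_m) : nat -> R :=
  fun i => if insub i is Some k then v ord0 k else t i.

(* Smoothness in infinitely many variables: all iterated partial derivatives
   exist and are jointly continuous in every finite set of variables, the
   other variables being fixed. *)
Definition smooth f : Prop :=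
  forall s : seq nat, let g := foldr partial f s in
    (forall j t, derivable (fun x => g (upd t j x)) (t j) 1) /\
    (forall m t, continuous (fun v : 'rV[R]_m => g (upd_first t v))).

Definition fdiv f g : timefun R := fun t => f t / g t.

(* [\sum_(i \in A)] is the sum over the finite support of the summand, which
   is finite in each use below as soon as the series are Laurent in p^-1. *)

Definition lconst f : lseries R := fun j => if j == 0 then f else 0.

Definition lscale f A : lseries R := fun j => f * A j.

Definition lmul A B : lseries R :=
  fun j => \sum_(i \in [set: int]) A i * B (j - i).

Definition lpow A (k : nat) : lseries R := iter k (lmul A) (lconst 1).

Definition geqpart (r : int) A : lseries R := fun j => if r <= j then A j else 0.

Definition ldp A : lseries R := fun j => A (j + 1) *~ (j + 1).
Definition ldT (k : nat) A : lseries R := fun j => dT k (A j).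
Definition ldX A : lseries R := ldT 1 A.

Definition bracket A B : lseries R := lmul (ldp A) (ldX B) - lmul (ldX A) (ldp B).

(* Value at p = f; meaningful when [A] has finitely many nonzero terms. *)
Definition leval A f : timefun R :=
  fun t => \sum_(j \in [set: int]) A j t * f t ^ j.

(* 1 / (p - b), expanded at p = oo; [Negz j] is the integer -(j+1). *)
Definition inv_psub (b : timefun R) : lseries R :=
  fun m => if m is Negz j then b ^+ j else 0.

(* p + (lower powers of p) *)
Definition sato A : Prop := A 1 = 1 /\ forall j : int, 1 < j -> A j = 0.

(* M^(1/n) and M^(k/n) *)
Definition lroot (n : nat) M : lseries R :=
  xget 0 [set A : lseries R | sato A /\ lpow A n = M].
Definition lfracpow M (k n : nat) : lseries R := lpow (lroot n M) k.

(* e^(- ad f) *)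
Definition exp_Nad f A : lseries R :=
  fun j => \sum_(l \in [set: nat])
             ((-1) ^+ l / l`!%:R) *: iter l (bracket (lconst f)) A j.

Definition Qpart (n k : nat) M : lseries R := geqpart 1 (lfracpow M k n).

Definition cdmKP_form (N : nat) M (a p : 'I_N -> timefun R) : Prop :=
  M = geqpart 1 M
      - \sum_(i < N) (lconst (fdiv (a i) (p i))
                      + lscale (a i) (inv_psub (p i))).

Definition cdmKP_flows (n N : nat) M (a p : 'I_N -> timefun R) : Prop :=
  forall k : nat, (1 <= k)%N ->
    [/\ ldT k M = bracket (Qpart n k M) M,
        forall i, dT k (a i) = dX (a i * leval (ldp (Qpart n k M)) (p i))
      & forall i, dT k (p i) = dX (leval (Qpart n k M) (p i))].

End Definitions.

(* Main.v *)
Require Import Defs.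
From mathcomp Require Import all_boot all_order all_algebra.
From mathcomp Require Import all_classical all_reals all_analysis.
From mathcomp Require Import ring lra zify.
Import Order.TTheory GRing.Theory Num.Theory.
Import numFieldNormedType.Exports.
Local Open Scope classical_set_scope.
Local Open Scope ring_scope.
Set Implicit Arguments.
Unset Strict Implicit.
Unset Printing Implicit Defensive.

(* With u = phi_X, the operator e^(- ad phi) is the substitution p := p + u,
   which is a ring homomorphism S commuting with the derivative in p.  As n-th
   roots of the form p + lower are unique, the root of S(L^n) is S(L), and
   splitting off nonpositive powers gives Q~_k = S(Q_k) - Q_k(u) =
   S(Q_k) - phi_(T_k).  Since S(1/(p - b)) = 1/(p - (b - u)), the constraint on
   phi yields the form of S(L^n).  Differentiating S(A) in T_k produces the extra
   term u_(T_k) S(A_p); the extra terms in X cancel in the bracket {S Q_k, S L^n},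
   and the one in T_k is absorbed by the constant phi_(T_k) because
   phi_(X T_k) = phi_(T_k X), which is Schwarz's theorem.  The flows of a_i and
   p_i - u follow from S(A)(f - u) = A(f). *)

(** * Finitely supported sums over [int] and [nat] as sums over ordinals *)

Lemma fsum_int_window (V : nmodType) (F : int -> V) (d : int) (m : nat) :
  (forall i, d < i -> F i = 0) -> (forall i, i <= d - m%:Z -> F i = 0) ->
  \sum_(i \in [set: int]) F i = \sum_(k < m) F (d - k%:Z).
Proof.
move=> Fhi Flo; rewrite -(@fsbig_widen _ _ _ _ [set` [seq d - k%:Z | k <- iota 0 m]] setT) //.
- rewrite -fsbig_seq; last first.
    by rewrite map_inj_uniq ?iota_uniq// => i j ?; lia.
  by rewrite big_map -(big_mkord xpredT (fun k => F (d - k%:Z))) /index_iota subn0.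
- move=> i [_ /= iNs]; have [/Fhi //|i_le] := ltP d i.
  have [/Flo //|i_gt] := leP i (d - m%:Z); exfalso.
  apply: iNs; apply/mapP; exists `|d - i|%N; last by lia.
  by rewrite mem_iota; lia.
Qed.

Lemma fsum_nat_window (V : nmodType) (F : nat -> V) (m : nat) :
  (forall i, (m <= i)%N -> F i = 0) ->
  \sum_(i \in [set: nat]) F i = \sum_(k < m) F k.
Proof.
move=> Fhi; rewrite -(@fsbig_widen _ _ _ _ [set` iota 0 m] setT) //.
- by rewrite -fsbig_seq ?iota_uniq// -(big_mkord xpredT F) /index_iota subn0.
- move=> i [_ /= iNs]; apply: Fhi; rewrite leqNgt; apply/negP => im.
  by apply: iNs; rewrite mem_iota.
Qed.

(** Regrouping by [s = i + l]: the part of the square beyond the antidiagonal contributes nothing.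
    It serves for products and compositions of Taylor expansions. *)
Lemma sum_square_triangle (V : nmodType) (F : nat -> nat -> V) (m : nat) :
  (forall i l, (m <= i + l)%N -> F i l = 0) ->
  \sum_(i < m) \sum_(l < m) F i l = \sum_(s < m) \sum_(i < s.+1) F i (s - i)%N.
Proof.
move=> F0.
transitivity (\sum_(s < m) \sum_(i < m | (i <= s)%N) F i (s - i)%N); last first.
  apply: eq_bigr => s _.
  by rewrite (big_ord_widen_cond m xpredT (fun i => F i (s - i)%N)).
rewrite [RHS](exchange_big_dep xpredT) //=; apply: eq_bigr => i _.
rewrite -(big_mkord xpredT (F i)) (big_cat_nat (n := (m - i)%N)) ?leq_subr //=.
(* In row [i] the terms with [l >= m - i] lie outside the triangle. *)
rewrite [X in _ + X]big1_seq ?addr0; last first.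
  by move=> l /=; rewrite mem_index_iota => /andP[+ _]; rewrite leq_subLR => /F0.
transitivity (\sum_(i <= s < m) F i (s - i)%N); last by rewrite big_geq_mkord.
have := big_addn 0 m i xpredT (fun s => F i (s - i)%N); rewrite add0n => ->.
by apply: eq_bigr => l _; rewrite addnK.
Qed.

Lemma ltz_nat (x : int) : exists m : nat, x < m%:Z.
Proof. by exists `|x|.+1; lia. Qed.

(** * Algebra of Laurent series with explicit degree bounds; divided powers *)

Section LaurentAlgebra.
Variable R : realType.
Implicit Types (f g u v : timefun R) (A B M : lseries R) (d e j : int).

Lemma lsubE A B j : (A - B) j = A j - B j. Proof. by []. Qed.
Lemma laddE A B j : (A + B) j = A j + B j. Proof. by []. Qed.

Definition deg_le d A : Prop := forall j, d < j -> A j = 0.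

Lemma deg_leW d e A : d <= e -> deg_le d A -> deg_le e A.
Proof. by move=> de Ad j ej; apply: Ad; apply: le_lt_trans ej. Qed.

(** The length [m] may be any sufficiently large number, so several products can be expanded over
    one common range of indices. *)
Lemma lmulE d e m A B j : deg_le d A -> deg_le e B -> d + e - j < m%:Z ->
  lmul A B j = \sum_(k < m) A (d - k%:Z) * B (j - d + k%:Z).
Proof.
move=> Ad Be jm; rewrite /lmul (@fsum_int_window _ _ d m).
- by apply: eq_bigr => k _; congr (_ * B _); lia.
- by move=> i di; rewrite Ad // mul0r.
- by move=> i im; rewrite Be ?mulr0 //; lia.
Qed.

Lemma lmul_deg d e A B : deg_le d A -> deg_le e B -> deg_le (d + e) (lmul A B).
Proof. by move=> Ad Be j dej; rewrite (lmulE (m := 0) Ad Be) ?big_ord0 //; lia. Qed.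

Lemma lmul_lead d e A B : deg_le d A -> deg_le e B ->
  lmul A B (d + e) = A d * B e.
Proof.
move=> Ad Be; rewrite (lmulE (m := 1) Ad Be); last by lia.
by rewrite big_ord1 subr0 addr0; congr (_ * B _); lia.
Qed.

Lemma lmulBl d e A A' B : deg_le d A -> deg_le d A' -> deg_le e B ->
  lmul (A - A') B = lmul A B - lmul A' B.
Proof.
move=> Ad Ad' Be; apply/funext => j.
have [m jm] := ltz_nat (d + e - j).
have AAd : deg_le d (A - A') by move=> i di; rewrite lsubE Ad // Ad' // subr0.
rewrite lsubE (lmulE AAd Be jm) (lmulE Ad Be jm) (lmulE Ad' Be jm).
by rewrite -sumrB; apply: eq_bigr => k _; rewrite -mulrBl.
Qed.

Lemma lmulBr d e A B B' : deg_le d A -> deg_le e B -> deg_le e B' ->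
  lmul A (B - B') = lmul A B - lmul A B'.
Proof.
move=> Ad Be Be'; apply/funext => j.
have [m jm] := ltz_nat (d + e - j).
have BBe : deg_le e (B - B') by move=> i ei; rewrite lsubE Be // Be' // subr0.
rewrite lsubE (lmulE Ad BBe jm) (lmulE Ad Be jm) (lmulE Ad Be' jm).
by rewrite -sumrB; apply: eq_bigr => k _; rewrite -mulrBr.
Qed.

Lemma lscale_deg d f A : deg_le d A -> deg_le d (lscale f A).
Proof. by move=> Ad j dj; rewrite /lscale Ad // mulr0. Qed.

Lemma lmulZl d e f A B : deg_le d A -> deg_le e B ->
  lmul (lscale f A) B = lscale f (lmul A B).
Proof.
move=> Ad Be; apply/funext => j.
have [m jm] := ltz_nat (d + e - j).
rewrite /lscale (lmulE Ad Be jm) (lmulE (lscale_deg f Ad) Be jm).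
by rewrite mulr_sumr; apply: eq_bigr => k _; rewrite mulrA.
Qed.

Lemma lmulZr d e f A B : deg_le d A -> deg_le e B ->
  lmul A (lscale f B) = lscale f (lmul A B).
Proof.
move=> Ad Be; apply/funext => j.
have [m jm] := ltz_nat (d + e - j).
rewrite /lscale (lmulE Ad Be jm) (lmulE Ad (lscale_deg f Be) jm).
by rewrite mulr_sumr; apply: eq_bigr => k _; rewrite mulrCA.
Qed.

Lemma lmul_const f A : lmul (lconst f) A = lscale f A.
Proof.
apply/funext => j; rewrite /lmul (@fsum_int_window _ _ 0 1).
- by rewrite big_ord1 /lconst /lscale !subr0 eqxx.
- by move=> i i0; rewrite /lconst gt_eqF // mul0r.
- by move=> i i0; rewrite /lconst lt_eqF ?mul0r//; lia.
Qed.

Lemma lconst_deg f : deg_le 0 (lconst f).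
Proof. by move=> j j0; rewrite /lconst gt_eqF. Qed.

Lemma ldp_deg d A : deg_le d A -> deg_le (d - 1) (ldp A).
Proof. by move=> Ad j dj; rewrite /ldp Ad ?mul0rz //; lia. Qed.

Lemma iter_ldp_deg d l A : deg_le d A -> deg_le (d - l%:Z) (iter l (@ldp R) A).
Proof.
move=> Ad; elim: l => [|l IHl] /=; first by rewrite subr0.
by apply: deg_leW (ldp_deg IHl); lia.
Qed.

Lemma ldpZ f A : ldp (lscale f A) = lscale f (ldp A).
Proof. by apply/funext => j; rewrite /ldp /lscale mulrzAr. Qed.

Lemma ldp_const f : ldp (lconst f) = 0.
Proof.
apply/funext => j; rewrite /ldp /lconst.
by case: eqP => [->|_]; rewrite ?mulr0z ?mul0rz.
Qed.

Lemma ldpB A B : ldp (A - B) = ldp A - ldp B.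
Proof. by apply/funext => j; rewrite lsubE /ldp lsubE mulrzBl. Qed.

Lemma ldpM d e A B : deg_le d A -> deg_le e B ->
  ldp (lmul A B) = lmul (ldp A) B + lmul A (ldp B).
Proof.
move=> Ad Be; apply/funext => j.
have [m jm] := ltz_nat (d + e - j).
rewrite laddE {1}/ldp.
rewrite (lmulE (m := m) Ad Be); last by lia.
rewrite (lmulE (m := m) (ldp_deg Ad) Be); last by lia.
rewrite (lmulE (m := m) Ad (ldp_deg Be)); last by lia.
rewrite -mulrzr mulr_suml -big_split; apply: eq_bigr => k _ /=; rewrite /ldp mulrzr.
have -> : d - 1 - k%:Z + 1 = d - k%:Z by lia.
have -> : j - (d - 1) + k%:Z = j - d + k%:Z + 1 by lia.
have -> : j + 1 - d + k%:Z = j - d + k%:Z + 1 by lia.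
rewrite mulrzAl mulrzAr -mulrzDr; congr (_ *~ _); lia.
Qed.

(** Coefficient [j] of the [l]-th derivative involves only coefficient [j + l] of the series. *)
Lemma iter_ldp_agree A B j l : (forall i, j <= i -> A i = B i) ->
  iter l (@ldp R) A j = iter l (@ldp R) B j.
Proof.
elim: l j => [|l IHl] j AB /=; first exact: AB.
by rewrite /ldp; congr (_ *~ _); apply: IHl => i ji; apply: AB; lia.
Qed.

(** The divided power u^l/l!. With it the binomial formula [dpowD] and the derivative
    [partial_dpowS] carry no numerical factors. *)
Definition dpow u (l : nat) : timefun R := (l`!%:R)^-1 *: u ^+ l.

Lemma dpow0 u : dpow u 0 = 1.
Proof. by rewrite /dpow fact0 invr1 scale1r expr0. Qed.

Lemma factR_neq0 (l : nat) : (l`!%:R : R) != 0.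
Proof. by rewrite pnatr_eq0 -lt0n fact_gt0. Qed.

Lemma dpowM u v i l :
  dpow u i * dpow v l = (i`!%:R * l`!%:R)^-1 *: (u ^+ i * v ^+ l).
Proof. by rewrite invfM; apply/funext => t; exact: mulrACA. Qed.

Lemma invf_bin s i : (i <= s)%N ->
  (i`!%:R * (s - i)`!%:R : R)^-1 = s`!%:R^-1 *+ 'C(s, i).
Proof.
move=> le_is; rewrite -(bin_fact le_is) !natrM -mulr_natr.
have C0 : ('C(s, i)%:R : R) != 0 by rewrite pnatr_eq0 -lt0n bin_gt0.
by field; rewrite !factR_neq0 C0.
Qed.

Lemma dpowD u v s :
  dpow (u + v) s = \sum_(i < s.+1) dpow u i * dpow v (s - i)%N.
Proof.
rewrite /dpow addrC exprDn scaler_sumr; apply: eq_bigr => i _.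
rewrite -!/(dpow _ _) dpowM invf_bin -1?ltnS //.
by rewrite -scalerMnr -scalerMnl [u ^+ i * _]mulrC.
Qed.

End LaurentAlgebra.

(** * The substitution p := p + u as a ring homomorphism, and its identification with e^(- ad
    phi) *)

Section Shift.
Variable R : realType.
Implicit Types (f g u v b : timefun R) (A B M : lseries R) (d e j : int).

(* The Taylor expansion of A(p + u). *)
Definition pshift u A : lseries R :=
  fun j => \sum_(l \in [set: nat]) dpow u l * iter l (@ldp R) A j.

Lemma pshiftE d m u A j : deg_le d A -> d - j < m%:Z ->
  pshift u A j = \sum_(l < m) dpow u l * iter l (@ldp R) A j.
Proof.
move=> Ad jm; rewrite /pshift (@fsum_nat_window _ _ m) // => l ml.
by rewrite (iter_ldp_deg (l := l) Ad) ?mulr0 //; lia.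
Qed.

Lemma pshift_deg d u A : deg_le d A -> deg_le d (pshift u A).
Proof. by move=> Ad j dj; rewrite (pshiftE (m := 0) u Ad) ?big_ord0 //; lia. Qed.

Lemma pshift_lead d u A : deg_le d A -> pshift u A d = A d.
Proof.
move=> Ad; rewrite (pshiftE (m := 1) u Ad) ?subrr //.
by rewrite big_ord1 dpow0 mul1r.
Qed.

Lemma iter_ldpB l A B :
  iter l (@ldp R) (A - B) = iter l (@ldp R) A - iter l (@ldp R) B.
Proof. by elim: l => //= l ->; rewrite ldpB. Qed.

Lemma pshiftB d u A B : deg_le d A -> deg_le d B ->
  pshift u (A - B) = pshift u A - pshift u B.
Proof.
move=> Ad Bd; apply/funext => j; have [m jm] := ltz_nat (d - j).
have ABd : deg_le d (A - B) by move=> i di; rewrite lsubE Ad // Bd // subr0.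
rewrite lsubE (pshiftE u ABd jm) (pshiftE u Ad jm) (pshiftE u Bd jm).
by rewrite -sumrB; apply: eq_bigr => l _; rewrite iter_ldpB lsubE mulrBr.
Qed.

Lemma pshift0 u : pshift u 0 = 0.
Proof. by rewrite -[0 in LHS](subrr (0 : lseries R)) (@pshiftB 0) // subrr. Qed.

Lemma pshiftD d u A B : deg_le d A -> deg_le d B ->
  pshift u (A + B) = pshift u A + pshift u B.
Proof.
move=> Ad Bd; have zd : deg_le d (0 : lseries R) by [].
rewrite -[in LHS](opprK B) -[- B]add0r (@pshiftB d) //.
  by rewrite (@pshiftB d) // pshift0 sub0r opprK.
by move=> j dj; rewrite lsubE Bd // subr0.
Qed.

(** The degree bound is proved together with the equation because additivity of the shift needs it
    for every partial sum. *)
Lemma pshift_sum d u (I : finType) (F : I -> lseries R) :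
  (forall i, deg_le d (F i)) ->
  deg_le d (\sum_i F i) /\ pshift u (\sum_i F i) = \sum_i pshift u (F i).
Proof.
move=> Fd; pose K (A B : lseries R) := deg_le d A /\ pshift u A = B.
apply: (big_ind2 K); first by split; [|exact: pshift0].
- move=> A A' B B' [Ad <-] [Bd <-]; split; last exact: pshiftD Ad Bd.
  by move=> j dj; rewrite laddE Ad // Bd // addr0.
- by move=> i _.
Qed.

Lemma iter_ldp_scale l f A :
  iter l (@ldp R) (lscale f A) = lscale f (iter l (@ldp R) A).
Proof. by elim: l => //= l ->; rewrite ldpZ. Qed.

Lemma pshift_scale d u f A : deg_le d A ->
  pshift u (lscale f A) = lscale f (pshift u A).
Proof.
move=> Ad; apply/funext => j; have [m jm] := ltz_nat (d - j).
rewrite (pshiftE u (lscale_deg f Ad) jm) /lscale (pshiftE u Ad jm) mulr_sumr.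
by apply: eq_bigr => l _; rewrite iter_ldp_scale mulrCA.
Qed.

Lemma pshift_const u f : pshift u (lconst f) = lconst f.
Proof.
apply/funext => j; rewrite /pshift (@fsum_nat_window _ _ 1).
  by rewrite big_ord1 dpow0 mul1r.
case=> // l _; rewrite iterSr ldp_const.
suff -> : iter l (@ldp R) 0 = 0 by rewrite mulr0.
by elim: l => //= l ->; apply/funext => i; rewrite /ldp mul0rz.
Qed.

Lemma pshift_ldp d u A : deg_le d A -> pshift u (ldp A) = ldp (pshift u A).
Proof.
move=> Ad; apply/funext => j; have [m jm] := ltz_nat (d - j).
rewrite /ldp -/(ldp A) (pshiftE (m := m) u (ldp_deg Ad)); last by lia.
rewrite (pshiftE (m := m) u Ad); last by lia.
rewrite -mulrzr mulr_suml; apply: eq_bigr => l _.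
by rewrite mulrzr -mulrzAr -iterSr.
Qed.

Lemma pshift_iter_ldp d u l A : deg_le d A ->
  iter l (@ldp R) (pshift u A) = pshift u (iter l (@ldp R) A).
Proof.
by move=> Ad; elim: l => //= l ->; rewrite (pshift_ldp u (iter_ldp_deg (l := l) Ad)).
Qed.

(** Pascal's rule: the inductive step of the Leibniz formula, freed from series. *)
Lemma sum_binomial_step (V : nmodType) (F : nat -> nat -> V) s :
  \sum_(i < s.+1) (F i.+1 (s - i)%N + F i (s - i).+1) *+ 'C(s, i)
  = \sum_(i < s.+2) F i (s.+1 - i)%N *+ 'C(s.+1, i).
Proof.
rewrite [RHS]big_ord_recl /= bin0 subn0.
under [X in _ = _ + X]eq_bigr => i _ do
  rewrite /bump /= add1n subSS binS mulrnDr.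
rewrite big_split /= addrA addrC; under eq_bigr do rewrite mulrnDl.
rewrite big_split /=; congr (_ + _).
rewrite big_ord_recl /= bin0 subn0 mulr1n.
rewrite [in RHS]big_ord_recr /= bin_small // mulr0n addr0; congr (_ + _).
by apply: eq_bigr => i _; rewrite /bump /= add1n -subSn.
Qed.

Lemma iter_ldpM d e s A B j : deg_le d A -> deg_le e B ->
  iter s (@ldp R) (lmul A B) j =
  \sum_(i < s.+1) lmul (iter i (@ldp R) A) (iter (s - i) (@ldp R) B) j *+ 'C(s, i).
Proof.
move=> Ad Be; elim: s j => [|s IHs] j; first by rewrite big_ord1 bin0.
rewrite iterS {1}/ldp IHs -mulrzr mulr_suml.
rewrite -(sum_binomial_step
  (fun i l => lmul (iter i (@ldp R) A) (iter l (@ldp R) B) j)).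
apply: eq_bigr => i _; rewrite mulrzr !pmulrn mulrzAC; congr (_ *~ _).
have := ldpM (iter_ldp_deg (l := i) Ad) (iter_ldp_deg (l := (s - i)%N) Be).
by move=> /(congr1 (fun C : lseries R => C j)); rewrite laddE.
Qed.

(** Both sides equal the double sum of products of Taylor terms: on the left the Leibniz formula
    groups them by total order of differentiation, on the right the two expansions are multiplied
    out. *)
Lemma pshiftM d e u A B : deg_le d A -> deg_le e B ->
  pshift u (lmul A B) = lmul (pshift u A) (pshift u B).
Proof.
move=> Ad Be; apply/funext => j; have [m jm] := ltz_nat (d + e - j).
pose EA i := lscale (dpow u i) (iter i (@ldp R) A).
pose EB i := lscale (dpow u i) (iter i (@ldp R) B).
have EAd i : deg_le (d - i%:Z) (EA i) by apply/lscale_deg/iter_ldp_deg.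
have EBe i : deg_le (e - i%:Z) (EB i) by apply/lscale_deg/iter_ldp_deg.
transitivity (\sum_(i < m) \sum_(l < m) lmul (EA i) (EB l) j).
  rewrite (pshiftE u (lmul_deg Ad Be) jm) (sum_square_triangle (F := fun i l => lmul (EA i) (EB l) j)).
    apply: eq_bigr => s _; rewrite (iter_ldpM s _ Ad Be) mulr_sumr.
    apply: eq_bigr => i _; rewrite /EA /EB.
    rewrite (lmulZl _ (iter_ldp_deg (l := i) Ad) (EBe _)).
    rewrite (lmulZr _ (iter_ldp_deg (l := i) Ad) (iter_ldp_deg (l := (s - i)%N) Be)).
    rewrite /lscale mulrA dpowM invf_bin -1?ltnS // -exprD subnKC -1?ltnS //.
    by rewrite /dpow mulrnAr -mulrnAl scalerMnl.
  move=> i l mil; rewrite (lmul_deg (EAd i) (EBe l)) //; lia.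
rewrite (lmulE (pshift_deg u Ad) (pshift_deg u Be) jm).
(* The sharper bounds of the Taylor terms are relaxed to [d] and [e], so that all products run over
   the same [m] indices and the sums can be interchanged. *)
under eq_bigr => i _ do under eq_bigr => l _ do
  rewrite (lmulE (deg_leW _ (EAd i)) (deg_leW _ (EBe l)) jm) ?lerBlDr ?lerDl //.
under eq_bigr do rewrite exchange_big /=.
rewrite exchange_big /=; apply: eq_bigr => k _.
rewrite (pshiftE (m := m) u Ad); last by have := ltn_ord k; lia.
rewrite (pshiftE (m := m) u Be); last by lia.
by rewrite mulr_suml; apply: eq_bigr => i _; rewrite mulr_sumr.
Qed.

(** Grouping the double Taylor sum by total order leaves the binomial expansion [dpowD] in front of
    each derivative. *)
Lemma pshift_pshift d u v A : deg_le d A ->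
  pshift u (pshift v A) = pshift (u + v) A.
Proof.
move=> Ad; apply/funext => j; have [m jm] := ltz_nat (d - j).
rewrite (pshiftE u (pshift_deg v Ad) jm) (pshiftE _ Ad jm).
under eq_bigr => l _.
  rewrite (pshift_iter_ldp v l Ad).
  rewrite (pshiftE (m := m) _ (iter_ldp_deg (l := l) Ad)); last by lia.
  rewrite mulr_sumr; under eq_bigr => i _ do rewrite -iterD addnC.
  over.
rewrite (sum_square_triangle (F := fun l i => dpow u l * (dpow v i * iter (l + i) (@ldp R) A j))).
  apply: eq_bigr => s _; rewrite dpowD mulr_suml; apply: eq_bigr => i _.
  by rewrite subnKC -1?ltnS // mulrA.
move=> i l mil; rewrite (iter_ldp_deg (l := (i + l)%N) Ad) ?mulr0 //; lia.
Qed.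

(** As [f] does not depend on p, {f, B} = - f_X B_p; iterating gives (- f_X)^l times the [l]-th
    derivative, and this sign cancels the one in the exponential. *)
Lemma exp_Nad_pshift f A : exp_Nad f A = pshift (dX f) A.
Proof.
have br B : bracket (lconst f) B = lscale (- dX f) (ldp B).
  rewrite /bracket ldp_const.
  have -> : ldX (lconst f) = lconst (dX f).
    apply/funext => j; rewrite /ldX /ldT /lconst; case: ifP => // _.
    by apply/funext => t; rewrite /dT /partial derive1_cst.
  rewrite lmul_const; apply/funext => j.
  rewrite lsubE /lscale mulNr /lmul fsbig1 ?sub0r // => i _.
  by rewrite mul0r.
have it l : iter l (bracket (lconst f)) A = lscale ((- dX f) ^+ l) (iter l (@ldp R) A).
  elim: l => [|l IHl]; first by apply/funext => j; rewrite /lscale expr0 mul1r.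
  by rewrite iterS IHl br ldpZ; apply/funext => j; rewrite /lscale mulrA -exprS.
apply/funext => j; apply: eq_fsbigr => l _; rewrite it /lscale /dpow.
rewrite (exprNn (dX f)); apply/funext => t.
have sgE : ((-1 : timefun R) ^+ l) t = (-1) ^+ l by rewrite exprfctE.
(* Evaluation at [t] brings both signs into the field [R], where their product is a square equal to
   [1]. *)
change ((-1) ^+ l / l`!%:R * (((-1 : timefun R) ^+ l) t * (dX f ^+ l) t * iter l (@ldp R) A j t)
  = l`!%:R^-1 * (dX f ^+ l) t * iter l (@ldp R) A j t).
rewrite sgE; have := sqrr_sign R l; rewrite expr2.
move: ((-1) ^+ l) => s ss; rewrite -[RHS]mul1r -ss; ring.
Qed.

End Shift.

(** * Evaluation, truncation, simple poles and n-th roots under the shift *)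

Section Parts.
Variable R : realType.
Implicit Types (f g u v b : timefun R) (A B M : lseries R) (d e j : int).

Lemma iter_ldp_nat l A (j : nat) :
  iter l (@ldp R) A j%:Z = A (j + l)%N%:Z *+ (j + l) ^_ l.
Proof.
elim: l j => [|l IHl] j; first by rewrite addn0 mulr1n.
rewrite iterS {1}/ldp -PoszD addn1 IHl addSnnS -pmulrn -mulrnA ffactnSr.
by congr (_ *+ (_ * _)%N); lia.
Qed.

Lemma iter_ldp_neg l A j : (forall i, i < 0 -> A i = 0) -> j < 0 ->
  iter l (@ldp R) A j = 0.
Proof.
move=> A0; elim: l j => [|l IHl] j j0 /=; first exact: A0.
(* At index -1 the derivative reads the constant coefficient, but with factor 0; at lower indices it
   reads negative ones. *)
rewrite /ldp; have [->|j1] := eqVneq j (-1); first by rewrite addNr mulr0z.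
by rewrite IHl ?mul0rz //; lia.
Qed.

(* For a polynomial in p, the constant term of A(p + f) is A(f). *)
Lemma leval_pshift d f A : deg_le d A -> (forall j, j < 0 -> A j = 0) ->
  leval A f = pshift f A 0.
Proof.
move=> Ad A0; have [m dm] := ltz_nat d.
rewrite (pshiftE (m := m.+1) f Ad); last by lia.
apply/funext => t; rewrite /leval (@fsum_int_window _ _ m%:Z m.+1).
(* Reversing the order pairs the power p^l with the [l]-th derivative, whose constant term is l!
   times coefficient [l]. *)
- rewrite fct_sumE [RHS](reindex_inj rev_ord_inj) /=; apply: eq_bigr => k _.
  rewrite (iter_ldp_nat _ _ 0) add0n ffactnn subSS /dpow.
  have -> : m%:Z - k%:Z = (m - k)%N%:Z by have := ltn_ord k; lia.
  have -> : (m - k)%N%:Z = 0 + (m - k)%N :> int by rewrite add0r.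
  rewrite add0r mulrnAr -mulrnAl scalerMnl -mulr_natr mulVf ?factR_neq0 //.
  by rewrite scale1r mulrC mulrfctE exprfctE.
- by move=> i mi; rewrite Ad ?mul0r //; lia.
- by move=> i im; rewrite A0 ?mul0r //; lia.
Qed.

Lemma pshift_neg u A : (forall j, j < 0 -> A j = 0) ->
  forall j, j < 0 -> pshift u A j = 0.
Proof.
by move=> A0 j j0; rewrite /pshift fsbig1 // => l _; rewrite iter_ldp_neg ?mulr0.
Qed.

(** Both values are constant terms of shifts, and shifting by [u] and then by [f - u] is shifting by
    [f]. *)
Lemma leval_shift d u f A : deg_le d A -> (forall j, j < 0 -> A j = 0) ->
  leval (pshift u A) (f - u) = leval A f.
Proof.
move=> Ad A0; rewrite (leval_pshift f Ad) //.
rewrite (leval_pshift _ (pshift_deg u Ad)); last exact: pshift_neg.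
by rewrite (pshift_pshift _ _ Ad) subrK.
Qed.

Lemma levalB_const d f g A : 0 <= d -> deg_le d A ->
  (forall j, j < 0 -> A j = 0) ->
  leval (A - lconst g) f = leval A f - g.
Proof.
move=> d0 Ad A0; have gd : deg_le d (lconst g) by apply: deg_leW (lconst_deg g).
rewrite (leval_pshift f Ad) // (@leval_pshift d).
- by rewrite (pshiftB f Ad gd) lsubE pshift_const.
- by move=> j dj; rewrite lsubE Ad // gd // subr0.
- by move=> j j0; rewrite lsubE A0 // sub0r /lconst lt_eqF // oppr0.
Qed.

Lemma geqpart_deg d r A : deg_le d A -> deg_le d (geqpart r A).
Proof. by move=> Ad j dj; rewrite /geqpart Ad //; case: ifP. Qed.

Lemma geqpart1_neg A j : j < 0 -> geqpart 1 A j = 0.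
Proof. by move=> j0; rewrite /geqpart ifF //; lia. Qed.

(** Nonpositive powers stay nonpositive under the shift, and the shifted positive part acquires no
    negative powers. What must be removed from the latter is its constant term, which is its value
    at [u] before shifting. *)
Lemma geqpart_pshift d u A : deg_le d A ->
  geqpart 1 (pshift u A) =
  pshift u (geqpart 1 A) - lconst (leval (geqpart 1 A) u).
Proof.
move=> Ad; apply/funext => j; rewrite lsubE /geqpart -/(geqpart 1 A) /lconst.
have [j1|j1] := leP 1 j.
  rewrite gt_eqF ?subr0; last by lia.
  apply: eq_fsbigr => l _; congr (_ * _); apply: iter_ldp_agree => i ji.
  by rewrite /geqpart ifT //; lia.
case: eqP => [->|j0].
  by rewrite (leval_pshift _ (geqpart_deg 1 Ad)) ?subrr // => i; exact: geqpart1_neg.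
rewrite subr0 /pshift fsbig1 // => l _.
by rewrite iter_ldp_neg ?mulr0 //; [move=> i; exact: geqpart1_neg|lia].
Qed.

Lemma iter_ldp_Vp l j :
  iter l (@ldp R) (fun i => if i == -1 then 1 else 0) j =
  if j == - (1 + l%:Z) then (-1) ^+ l *+ l`! else 0.
Proof.
elim: l j => [|l IHl] j; first by rewrite addr0 mulr1n.
rewrite iterS /ldp IHl; have [->|j1] := eqVneq j (- (1 + l.+1%:Z)).
  have -> : - (1 + l.+1%:Z) + 1 = - (1 + l%:Z) by lia.
  by rewrite eqxx -intS mulrNz -pmulrn -mulrnA exprS mulN1r mulNrn factS mulnC.
by rewrite ifF ?mul0rz //; lia.
Qed.

(** The geometric series of 1/(p - b) is the Taylor expansion of 1/p, the monomial on the right,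
    moved by [- b]. *)
Lemma inv_psub_pshift b : inv_psub b = pshift (- b) (fun i => if i == -1 then 1 else 0).
Proof.
have Vd : deg_le (-1) (fun i => if i == -1 then 1 else 0 : timefun R).
  by move=> i i1; rewrite gt_eqF.
apply/funext => -[j|j].
  by rewrite (pshift_deg _ Vd).
rewrite (pshiftE (m := j.+1) _ Vd) /=; last by lia.
(* The [l]-th derivative of 1/p is a single monomial of degree -(1 + l), so only the last term,
   [l = j], reaches this coefficient. *)
rewrite big_ord_recr /= big1 ?add0r => [|l _]; last first.
  by rewrite iter_ldp_Vp ifF ?mulr0 //; have := ltn_ord l; lia.
rewrite iter_ldp_Vp ifT; last by lia.
rewrite mulrnAr -mulrnAl /dpow scalerMnl -mulr_natr mulVf ?factR_neq0 //.
by rewrite scale1r -exprMn mulrN1 opprK.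
Qed.

Lemma pshift_inv_psub u b : pshift u (inv_psub b) = inv_psub (b - u).
Proof.
have Vd : deg_le (-1) (fun i => if i == -1 then 1 else 0 : timefun R).
  by move=> i i1; rewrite gt_eqF.
by rewrite !inv_psub_pshift (pshift_pshift _ _ Vd) opprB addrC.
Qed.

Lemma inv_psub_deg b : deg_le (-1) (inv_psub b).
Proof. by case=> [j|j] jl //; exfalso; lia. Qed.

Lemma lpowS k A : lpow A k.+1 = lmul A (lpow A k).
Proof. by []. Qed.

Lemma lpow_deg k A : sato A -> deg_le k%:Z (lpow A k).
Proof.
move=> [_ A1]; elim: k => [|k IHk]; first exact: lconst_deg.
by rewrite lpowS; apply: deg_leW (lmul_deg A1 IHk); lia.
Qed.

Lemma lpow_lead k A : sato A -> lpow A k k%:Z = 1.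
Proof.
move=> sA; elim: k => [//|k IHk]; rewrite intS lpowS.
by rewrite (lmul_lead sA.2 (lpow_deg (k := k) sA)) IHk sA.1 mulr1.
Qed.

(** The first coefficient at which [A] and [B] may differ shows up in the difference of their [k]-th
    powers multiplied by [k], because both have leading term p. *)
Lemma lpow_sub i0 k A B : sato A -> sato B ->
  (forall i, i0 < i -> A i = B i) ->
  deg_le (k%:Z - 1 + i0) (lpow A k - lpow B k) /\
  (lpow A k - lpow B k) (k%:Z - 1 + i0) = (A i0 - B i0) *+ k.
Proof.
move=> sA sB AB; elim: k => [|k [IHd IHl]].
  by rewrite subrr mulr0n; split.
have ABd : deg_le i0 (A - B) by move=> i /AB; rewrite lsubE => ->; rewrite subrr.
have kA := lpow_deg (k := k) sA; have kB := lpow_deg (k := k) sB.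
(* Telescoping: A^(k+1) - B^(k+1) = (A - B) A^k + B (A^k - B^k). *)
have -> : lpow A k.+1 - lpow B k.+1 =
    lmul (A - B) (lpow A k) + lmul B (lpow A k - lpow B k).
  rewrite (lmulBl sA.2 sB.2 kA) (lmulBr sB.2 kA kB) !lpowS.
  by rewrite addrA subrK.
have e1 : k.+1%:Z - 1 + i0 = i0 + k%:Z by lia.
have e2 : k.+1%:Z - 1 + i0 = 1 + (k%:Z - 1 + i0) by lia.
split.
  move=> j jl; rewrite laddE (lmul_deg ABd kA) -?e1 //.
  by rewrite (lmul_deg sB.2 IHd) -?e2 // addr0.
rewrite laddE {1}e1 (lmul_lead ABd kA) lpow_lead // mulr1.
by rewrite e2 (lmul_lead sB.2 IHd) sB.1 mul1r IHl mulrS.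
Qed.

Lemma lpow_inj n A B : (1 <= n)%N -> sato A -> sato B ->
  lpow A n = lpow B n -> A = B.
Proof.
move=> n1 sA sB AB.
(* Induction down the degrees, starting above degree 1 where both series vanish; each further
   coefficient is settled by [lpow_sub], as [n] is nonzero in [R]. *)
have agree (m : nat) i : 1 - m%:Z < i -> A i = B i.
  elim: m i => [|m IHm] i im.
    by rewrite sA.2 ?sB.2 //; lia.
  have [mi|im'] := ltP (1 - m%:Z) i; first exact: IHm.
  have -> : i = 1 - m%:Z by lia.
  have [_] := lpow_sub n sA sB IHm.
  rewrite AB subrr => /esym /eqP; rewrite -scaler_nat scaler_eq0 pnatr_eq0.
  by case: n n1 {AB} => //= n _; rewrite subr_eq0 => /eqP.
apply/funext => i; have [m im] := ltz_nat (1 - i).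
by apply: (agree m); lia.
Qed.

Lemma lroot_lpow n A : (1 <= n)%N -> sato A -> lroot n (lpow A n) = A.
Proof.
by move=> n1 sA; apply: xget_unique => // B [sB /(lpow_inj n1 sB sA)].
Qed.

Lemma pshift_sato u A : sato A -> sato (pshift u A).
Proof.
by move=> [A1 Ad]; split; [rewrite (pshift_lead u Ad)|exact: pshift_deg].
Qed.

Lemma pshift_lpow u k A : sato A -> pshift u (lpow A k) = lpow (pshift u A) k.
Proof.
move=> sA; elim: k => [|k IHk]; first exact: pshift_const.
by rewrite !lpowS (pshiftM u sA.2 (lpow_deg (k := k) sA)) IHk.
Qed.

Lemma Qpart_lpow n k A : (1 <= n)%N -> sato A ->
  Qpart n k (lpow A n) = geqpart 1 (lpow A k).
Proof. by move=> n1 sA; rewrite /Qpart /lfracpow lroot_lpow. Qed.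

End Parts.

(** * Schwarz's theorem for functions of two real variables *)

Section MixedPartials.
Variable R : realType.

(* Two applications of the mean value theorem to the second difference of g
   over the square with lower left corner (x0, y0) and side h. *)
Lemma second_difference_MVT (g gx gxy : R -> R -> R) (x0 y0 h : R) :
  0 < h ->
  (forall x y : R, is_derive x 1 (fun s => g s y) (gx x y)) ->
  (forall x y : R, is_derive y 1 (gx x) (gxy x y)) ->
  exists x y, [/\ `|x - x0| < h, `|y - y0| < h &
    g (x0 + h) (y0 + h) - g (x0 + h) y0 - (g x0 (y0 + h) - g x0 y0)
    = gxy x y * h * h].
Proof.
move=> h0 dgx dgxy.
have cont (F dF : R -> R) a b : (forall x : R, is_derive x 1 F (dF x)) ->
    {within `[a, b], continuous F}.
  move=> dF_; apply: derivable_within_continuous => x _.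
  by have [] := dF_ x.
(* The increment of [g] from the lower to the upper edge, as a function of the horizontal
   coordinate. *)
have dphi (x : R) : is_derive x 1 ((fun s => g s (y0 + h)) - (fun s => g s y0))
    (gx x (y0 + h) - gx x y0).
  exact: is_deriveB.
have xh : x0 < x0 + h by rewrite ltrDl.
have yh : y0 < y0 + h by rewrite ltrDl.
have [x + phiE] := MVT xh (fun x _ => dphi x) (cont _ _ _ _ dphi).
have [y + gxE] := MVT yh (fun y _ => dgxy x y) (cont _ _ _ _ (dgxy x)).
rewrite !in_itv /= => /andP[y1 y2] /andP[x1 x2]; exists x, y; split.
- by rewrite ger0_norm; lra.
- by rewrite ger0_norm; lra.
- move: phiE; rewrite /= gxE.
  have -> : x0 + h - x0 = h by ring.
  have -> : y0 + h - y0 = h by ring.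
  by move=> <-.
Qed.

Definition jointly_continuous_at (F : R -> R -> R) (x0 y0 : R) : Prop :=
  forall e, 0 < e -> exists2 d, 0 < d &
    forall x y, `|x - x0| < d -> `|y - y0| < d -> `|F x y - F x0 y0| < e.

(** The second difference is symmetric in the two variables, so each mixed derivative, taken at some
    point of the square, equals it divided by h^2; continuity lets the square shrink to its
    corner. *)
Lemma mixed_derivatives_eq (g gx gy gxy gyx : R -> R -> R) (x0 y0 : R) :
  (forall x y : R, is_derive x 1 (fun s => g s y) (gx x y)) ->
  (forall x y : R, is_derive y 1 (g x) (gy x y)) ->
  (forall x y : R, is_derive y 1 (gx x) (gxy x y)) ->
  (forall x y : R, is_derive x 1 (fun s => gy s y) (gyx x y)) ->
  jointly_continuous_at gxy x0 y0 -> jointly_continuous_at gyx x0 y0 ->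
  gxy x0 y0 = gyx x0 y0.
Proof.
move=> dgx dgy dgxy dgyx cxy cyx; apply/eqP; rewrite -subr_eq0 -normr_le0.
apply/ler_addgt0Pr => e e0; rewrite add0r.
have e20 : 0 < e / 2 by lra.
have [d1 d10 c1] := cxy _ e20; have [d2 d20 c2] := cyx _ e20.
pose h := Num.min d1 d2; have h0 : 0 < h by rewrite lt_min d10.
have [x [y [xh yh D1]]] := second_difference_MVT x0 y0 h0 dgx dgxy.
have [y' [x' [yh' xh' D2]]] :=
  second_difference_MVT (g := fun y x => g x y) y0 x0 h0
    (fun y x => dgy x y) (fun y x => dgyx x y).
have h1 : h <= d1 by rewrite ge_min lexx.
have h2 : h <= d2 by rewrite ge_min lexx orbT.
have {}c1 := c1 _ _ (lt_le_trans xh h1) (lt_le_trans yh h1).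
have {}c2 := c2 _ _ (lt_le_trans xh' h2) (lt_le_trans yh' h2).
have E : gxy x y = gyx x' y'.
  have hn0 : h != 0 by rewrite gt_eqF.
  by apply: (mulIf hn0); apply: (mulIf hn0); rewrite -D1 -D2; ring.
have -> : gxy x0 y0 - gyx x0 y0 =
  (gyx x' y' - gyx x0 y0) - (gxy x y - gxy x0 y0) by rewrite E; ring.
by apply: le_trans (ler_normB _ _) _; lra.
Qed.

End MixedPartials.

(** * Commuting partial derivatives in infinitely many variables *)

Section PartialDerivatives.
Variable R : realType.
Implicit Types (f g u : timefun R) (A B M : lseries R) (t : nat -> R).

Lemma upd_id t j : upd t j (t j) = t.
Proof. by apply/funext => i; rewrite /upd; case: eqP => [->|]. Qed.

Lemma upd_upd t j x y : upd (upd t j x) j y = upd t j y.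
Proof. by apply/funext => i; rewrite /upd; case: eqP. Qed.

Lemma updE t j x : upd t j x j = x.
Proof. by rewrite /upd eqxx. Qed.

Lemma updC t i j x y : i != j ->
  upd (upd t i x) j y = upd (upd t j y) i x.
Proof.
move=> ij; apply/funext => k; rewrite /upd.
by case: eqP => // ->; rewrite eq_sym (negbTE ij).
Qed.

(* A one-constructor family rather than a definition: unification must not
   unfold it into limits of difference quotients. *)
Variant pderivable (j : nat) f : Prop :=
  PDerivable of forall t, derivable (fun x => f (upd t j x)) (t j) 1.

Lemma smooth_pderivable j f : smooth f -> pderivable j f.
Proof. by move=> sf; split=> t; have [+ _] := sf [::]; apply. Qed.

Lemma smooth_partial i f : smooth f -> smooth (partial i f).
Proof. by move=> sf s; have := sf (rcons s i); rewrite foldr_rcons. Qed.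

Lemma is_derive_partial j f t (x : R) : pderivable j f ->
  is_derive x 1 (fun s => f (upd t j s)) (partial j f (upd t j x)).
Proof.
move=> [df]; have E : (fun s => f (upd (upd t j x) j s)) = (fun s => f (upd t j s)).
  by apply/funext => s; rewrite upd_upd.
have := df (upd t j x); rewrite /partial E updE derive1E; exact: derivableP.
Qed.

(** [smooth] provides joint continuity in the first [m] coordinates; [m] is chosen beyond both [i]
    and [j], so that the two moving coordinates fit into one row vector. *)
Lemma continuous_upd2 f t i j : i != j -> smooth f ->
  jointly_continuous_at (fun x y => f (upd (upd t i x) j y)) (t i) (t j).
Proof.
move=> ij sf e e0; pose m := (maxn i j).+1.
pose w x y : 'rV[R]_m := \row_k upd (upd t i x) j y k.
have wE x y : upd (upd t i x) j y = upd_first t (w x y).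
  apply/funext => k; rewrite /upd_first; case: insubP => [l _ lk|].
    by rewrite mxE lk.
  rewrite -leqNgt => mk; rewrite /upd !gtn_eqF //; apply: leq_trans mk.
    by rewrite ltnS leq_maxl.
  by rewrite ltnS leq_maxr.
have [_ /(_ m t (w (t i) (t j)))] := sf [::].
move=> /cvgrPdist_lt /(_ e e0) /nbhs_ballP[d d0 dP]; exists d => // x y xd yd.
rewrite !wE distrC; apply: dP; split=> // a k; rewrite !mxE /ball /= /upd.
case: eqP => _; first by rewrite distrC.
case: eqP => _; first by rewrite distrC.
by rewrite subrr normr0.
Qed.

Lemma partialC i j f : smooth f ->
  partial i (partial j f) = partial j (partial i f).
Proof.
move=> sf; have [->//|ij] := eqVneq i j; apply/funext => t.
have sfi := smooth_partial i sf; have sfj := smooth_partial j sf.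
pose G (F : timefun R) x y := F (upd (upd t i x) j y).
have tE F : F t = G F (t i) (t j) :> R by rewrite /G upd_id upd_id.
have dx F : smooth F -> forall x y : R,
    is_derive x 1 (fun s => G F s y) (G (partial i F) x y).
  move=> sF x y.
  have -> : (fun s => G F s y) = (fun s => F (upd (upd t j y) i s)).
    by apply/funext => s; rewrite /G updC.
  by rewrite /G updC //; apply: is_derive_partial; apply: smooth_pderivable.
have dy F : smooth F -> forall x y : R,
    is_derive y 1 (G F x) (G (partial j F) x y).
  by move=> sF x y; apply: is_derive_partial; apply: smooth_pderivable.
rewrite !tE; symmetry; apply: (@mixed_derivatives_eq _ (G f)
  (G (partial i f)) (G (partial j f))).
- exact: dx.
- exact: dy.
- exact: dy.
- exact: dx.
- by apply: continuous_upd2 => //; exact: smooth_partial.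
- by apply: continuous_upd2 => //; exact: smooth_partial.
Qed.

End PartialDerivatives.

(** * Differentiation rules for coefficients, series, shifts and brackets *)

Section Derivations.
Variable R : realType.
Implicit Types (f g u v : timefun R) (A B M : lseries R) (d j : int).

Lemma pderivableD i f g : pderivable i f -> pderivable i g -> pderivable i (f + g).
Proof. by move=> [df] [dg]; split=> t; exact: derivableD (df t) (dg t). Qed.

Lemma pderivableM i f g : pderivable i f -> pderivable i g -> pderivable i (f * g).
Proof. by move=> [df] [dg]; split=> t; exact: derivableM (df t) (dg t). Qed.

Lemma pderivable_cst i (c : R) : pderivable i (cst c).
Proof. by split=> t; exact: derivable_cst. Qed.

Lemma pderivable0 i : pderivable i (0 : timefun R).
Proof. exact: pderivable_cst. Qed.

Lemma pderivableZ i (c : R) f : pderivable i f -> pderivable i (c *: f).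
Proof. by move=> [df]; split=> t; exact: derivableZ (df t). Qed.

Lemma pderivable_sum i m (F : nat -> timefun R) :
  (forall l, pderivable i (F l)) -> pderivable i (\sum_(l < m) F l).
Proof.
move=> dF; elim: m => [|m IHm]; first by rewrite big_ord0; exact: pderivable0.
by rewrite big_ord_recr; apply: pderivableD.
Qed.

Lemma pderivableX i f l : pderivable i f -> pderivable i (f ^+ l).
Proof.
move=> df; elim: l => [|l IHl]; first by rewrite expr0; exact: pderivable_cst.
by rewrite exprS; apply: pderivableM.
Qed.

Lemma mulrz_scale f (z : int) : f *~ z = z%:~R *: f.
Proof. by rewrite scaler_int. Qed.

Lemma pderivable_mulrz i f (z : int) : pderivable i f -> pderivable i (f *~ z).
Proof. by rewrite mulrz_scale; exact: pderivableZ. Qed.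

Lemma partialD i f g : pderivable i f -> pderivable i g ->
  partial i (f + g) = partial i f + partial i g.
Proof.
move=> [df] [dg]; apply/funext => t.
change (partial i (f + g) t = partial i f t + partial i g t).
rewrite /partial !derive1E; exact: deriveD (df t) (dg t).
Qed.

Lemma partialB i f g : pderivable i f -> pderivable i g ->
  partial i (f - g) = partial i f - partial i g.
Proof.
move=> [df] [dg]; apply/funext => t.
change (partial i (f - g) t = partial i f t - partial i g t).
rewrite /partial !derive1E; exact: deriveB (df t) (dg t).
Qed.

Lemma partialM i f g : pderivable i f -> pderivable i g ->
  partial i (f * g) = partial i f * g + f * partial i g.
Proof.
move=> [df] [dg]; apply/funext => t.
change (partial i (f * g) t = partial i f t * g t + f t * partial i g t).
rewrite /partial !derive1E (deriveM (df t) (dg t)) upd_id addrC.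
by rewrite [X in X + _ = _]mulrC.
Qed.

Lemma partialZ i (c : R) f : pderivable i f -> partial i (c *: f) = c *: partial i f.
Proof.
move=> [df]; apply/funext => t; change (partial i (c *: f) t = c *: partial i f t).
by rewrite /partial !derive1E; exact: deriveZ (df t).
Qed.

Lemma partial_cst i (c : R) : partial i (cst c) = 0.
Proof. by apply/funext => t; rewrite /partial derive1_cst. Qed.

Lemma partial_mulrz i f (z : int) : pderivable i f ->
  partial i (f *~ z) = partial i f *~ z.
Proof. by move=> df; rewrite !mulrz_scale partialZ. Qed.

Lemma partial_sum i m (F : nat -> timefun R) : (forall l, pderivable i (F l)) ->
  partial i (\sum_(l < m) F l) = \sum_(l < m) partial i (F l).
Proof.
move=> dF; elim: m => [|m IHm]; first by rewrite !big_ord0 (partial_cst i 0).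
by rewrite !big_ord_recr /= partialD ?IHm //; exact: pderivable_sum.
Qed.

Lemma partialX i f l : pderivable i f ->
  partial i (f ^+ l.+1) = (f ^+ l * partial i f) *+ l.+1.
Proof.
move=> df; elim: l => [|l IHl]; first by rewrite expr1 expr0 mul1r.
rewrite exprS partialM //; last exact: pderivableX.
by rewrite IHl mulrnAr mulrA -exprS [partial i f * _]mulrC -mulrS.
Qed.

Lemma pderivable_dpow i u l : pderivable i u -> pderivable i (dpow u l).
Proof. by move=> du; apply/pderivableZ/pderivableX. Qed.

Lemma partial_dpow0 i u : partial i (dpow u 0) = 0.
Proof. by rewrite dpow0 (partial_cst i 1). Qed.

Lemma partial_dpowS i u l : pderivable i u ->
  partial i (dpow u l.+1) = dpow u l * partial i u.
Proof.
move=> du; rewrite /dpow partialZ ?partialX //; last exact: pderivableX.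
rewrite -scalerMnr scalerMnl -mulr_natr factS natrM invfM mulrAC.
rewrite mulVf ?pnatr_eq0 // mul1r.
by apply/funext => t; exact: mulrA.
Qed.

Lemma pderivable_ldp i A : (forall j, pderivable i (A j)) ->
  forall j, pderivable i (ldp A j).
Proof. by move=> dA j; apply: pderivable_mulrz. Qed.

Lemma pderivable_iter_ldp i l A : (forall j, pderivable i (A j)) ->
  forall j, pderivable i (iter l (@ldp R) A j).
Proof. by move=> dA; elim: l => //= l IHl; apply: pderivable_ldp. Qed.

Lemma pderivable_lmul i d e A B : deg_le d A -> deg_le e B ->
  (forall j, pderivable i (A j)) -> (forall j, pderivable i (B j)) ->
  forall j, pderivable i (lmul A B j).
Proof.
move=> Ad Be dA dB j; have [m jm] := ltz_nat (d + e - j).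
rewrite (lmulE Ad Be jm).
apply: (@pderivable_sum _ _ (fun k => A (d - k%:Z) * B (j - d + k%:Z))) => k.
exact: pderivableM.
Qed.

Lemma pderivable_lpow i k A : sato A -> (forall j, pderivable i (A j)) ->
  forall j, pderivable i (lpow A k j).
Proof.
move=> sA dA; elim: k => [|k IHk].
  move=> j; rewrite /lpow /= /lconst; case: ifP => _; exact: pderivable_cst.
exact: pderivable_lmul sA.2 (lpow_deg (k := k) sA) dA IHk.
Qed.

Lemma pderivable_geqpart i r A : (forall j, pderivable i (A j)) ->
  forall j, pderivable i (geqpart r A j).
Proof. by move=> dA j; rewrite /geqpart; case: ifP => // _; exact: pderivable0. Qed.

Lemma pderivable_pshift i d u A : deg_le d A -> pderivable i u ->
  (forall j, pderivable i (A j)) -> forall j, pderivable i (pshift u A j).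
Proof.
move=> Ad du dA j; have [m jm] := ltz_nat (d - j); rewrite (pshiftE u Ad jm).
apply: (@pderivable_sum _ _ (fun l => dpow u l * iter l (@ldp R) A j)) => l.
by apply: pderivableM; [exact: pderivable_dpow|exact: pderivable_iter_ldp].
Qed.

Lemma ldT_deg k d A : deg_le d A -> deg_le d (ldT k A).
Proof. by move=> Ad j dj; rewrite /ldT Ad // /dT (partial_cst _ 0). Qed.

Lemma ldT_ldp k A : (forall j, pderivable k.-1 (A j)) ->
  ldT k (ldp A) = ldp (ldT k A).
Proof. by move=> dA; apply/funext => j; rewrite /ldT /ldp /dT partial_mulrz. Qed.

Lemma ldT_iter_ldp k l A : (forall j, pderivable k.-1 (A j)) ->
  ldT k (iter l (@ldp R) A) = iter l (@ldp R) (ldT k A).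
Proof.
move=> dA; elim: l => //= l <-.
by rewrite ldT_ldp // => j; exact: pderivable_iter_ldp.
Qed.

(** The chain rule for A(p + u): the product rule is applied to each Taylor term. *)
Lemma ldT_pshift k d u A : deg_le d A -> pderivable k.-1 u ->
  (forall j, pderivable k.-1 (A j)) ->
  ldT k (pshift u A) = pshift u (ldT k A) + lscale (dT k u) (pshift u (ldp A)).
Proof.
move=> Ad du dA; apply/funext => j; have [m jm] := ltz_nat (d - j).
rewrite laddE /ldT /dT /lscale -/(ldT k A).
rewrite (pshiftE (m := m.+1) u Ad); last by lia.
rewrite (pshiftE (m := m.+1) u (ldT_deg k Ad)); last by lia.
rewrite (pshiftE (m := m) u (ldp_deg Ad)); last by lia.
rewrite (@partial_sum _ _ (fun l => dpow u l * iter l (@ldp R) A j)); last first.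
  by move=> l; apply: pderivableM; [exact: pderivable_dpow|exact: pderivable_iter_ldp].
transitivity (\sum_(l < m.+1) dpow u l * iter l (@ldp R) (ldT k A) j +
    \sum_(l < m.+1) partial k.-1 (dpow u l) * iter l (@ldp R) A j).
  rewrite -big_split; apply: eq_bigr => l _ /=.
  rewrite partialM; [|exact: pderivable_dpow|exact: pderivable_iter_ldp].
  by rewrite -ldT_iter_ldp // addrC.
(* The term of order 0 has constant coefficient 1; the others, lowered by one order, form the
   expansion of the shifted p-derivative, hence [m] terms against [m.+1]. *)
congr (_ + _); rewrite big_ord_recl partial_dpow0 mul0r add0r mulr_sumr.
by apply: eq_bigr => l _; rewrite lift0 partial_dpowS // iterSr mulrAC mulrC.
Qed.

Lemma ldTB k A B : (forall j, pderivable k.-1 (A j)) ->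
  (forall j, pderivable k.-1 (B j)) -> ldT k (A - B) = ldT k A - ldT k B.
Proof. by move=> dA dB; apply/funext => j; rewrite /ldT lsubE /dT partialB. Qed.

Lemma ldT_const k f : ldT k (lconst f) = lconst (dT k f).
Proof.
apply/funext => j; rewrite /ldT /lconst; case: ifP => // _.
exact: (partial_cst _ 0).
Qed.

Lemma bracket_pshift d e u Q M : deg_le d Q -> deg_le e M -> pderivable 0 u ->
  (forall j, pderivable 0 (Q j)) -> (forall j, pderivable 0 (M j)) ->
  bracket (pshift u Q) (pshift u M) = pshift u (bracket Q M).
Proof.
move=> Qd Me du dQ dM.
(* The chain rule solved for the shift of the X-derivative. *)
have XE a A : deg_le a A -> (forall j, pderivable 0 (A j)) ->
    pshift u (ldX A) = ldX (pshift u A) - lscale (dX u) (ldp (pshift u A)).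
  move=> Aa dA; rewrite -(pshift_ldp u Aa) /ldX (@ldT_pshift 1 a) //.
  by rewrite addrK.
have Qp := pshift_deg u Qd; have Mp := pshift_deg u Me.
have dQp := ldp_deg Qp; have dMp := ldp_deg Mp.
have XQp : deg_le d (ldX (pshift u Q)) by exact: ldT_deg.
have XMp : deg_le e (ldX (pshift u M)) by exact: ldT_deg.
rewrite /bracket (@pshiftB _ (d + e - 1)).
- rewrite (pshiftM u (ldp_deg Qd) (ldT_deg 1 Me)).
  rewrite (pshiftM u (ldT_deg 1 Qd) (ldp_deg Me)).
  rewrite !(pshift_ldp u Qd) !(pshift_ldp u Me) (XE d Q) // (XE e M) //.
  have dMe : deg_le e (ldp (pshift u M)) by apply: deg_leW dMp; lia.
  have dQd : deg_le d (ldp (pshift u Q)) by apply: deg_leW dQp; lia.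
  rewrite (lmulBr dQp XMp (lscale_deg _ dMe)) (lmulBl XQp (lscale_deg _ dQd) dMp).
  (* The two extra terms are both u_X times the product of the p-derivatives, with opposite
     signs. *)
  by rewrite (lmulZr _ dQp dMp) (lmulZl _ dQp dMp) opprB addrA subrK.
- by apply: deg_leW (lmul_deg (ldp_deg Qd) (ldT_deg 1 Me)); lia.
- by apply: deg_leW (lmul_deg (ldT_deg 1 Qd) (ldp_deg Me)); lia.
Qed.

End Derivations.

(** * Transport of the constrained form and of the flows *)

Section Transformation.
Variable R : realType.
Implicit Types (f g u : timefun R) (A B M : lseries R) (d e : int).

Lemma bracketB_const d e f A M : 0 <= d -> deg_le d A -> deg_le e M ->
  (forall j, pderivable 0 (A j)) -> pderivable 0 f ->
  bracket (A - lconst f) M = bracket A M + lscale (dX f) (ldp M).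
Proof.
move=> d0 Ad Me dA df; rewrite /bracket ldpB ldp_const subr0.
rewrite [ldX (A - _)]ldTB //; last first.
  by move=> j; rewrite /lconst; case: ifP => // _; exact: pderivable0.
rewrite ldT_const -/(ldX A).
have fd : deg_le d (lconst (dX f)) by apply: deg_leW (lconst_deg _).
rewrite (lmulBl (ldT_deg 1 Ad) fd (ldp_deg Me)) lmul_const.
by rewrite opprB addrA addrAC.
Qed.

(** Subtracting [f] from the Hamiltonian adds f_X times the p-derivative of the shifted [M], which
    is exactly the chain rule term with u_(T_k). It is applied to u = phi_X and f = phi_(T_k). *)
Lemma flow_pshift k d e u f Q M : 0 <= d -> deg_le d Q -> deg_le e M ->
  (forall j, pderivable 0 (Q j)) ->
  (forall i j, pderivable i (M j)) -> (forall i, pderivable i u) ->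
  pderivable 0 f -> dT k u = dX f ->
  ldT k M = bracket Q M ->
  ldT k (pshift u M) = bracket (pshift u Q - lconst f) (pshift u M).
Proof.
move=> d0 Qd Me dQ dM du df uf MQ.
rewrite (ldT_pshift Me) // MQ (bracketB_const d0 (pshift_deg u Qd) (pshift_deg u Me)) //.
  by rewrite (bracket_pshift Qd Me) // uf (pshift_ldp u Me).
exact: pderivable_pshift Qd (du 0%N) dQ.
Qed.

Lemma lconstD f g : lconst (f + g) = lconst f + lconst g.
Proof. by apply/funext => j; rewrite laddE /lconst; case: ifP => // _; rewrite addr0. Qed.

Lemma lconst0 : lconst 0 = 0 :> lseries R.
Proof. by apply/funext => j; rewrite /lconst; case: ifP. Qed.

(** The poles move to [p i - u]. The constant removed on truncating is the sum prescribed for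
    [leval (geqpart 1 M) u]: its a/p part accounts for the old constants and its a/(u - p) part,
    with sign reversed, gives the new ones. *)
Lemma cdmKP_form_pshift d N u M (a p : 'I_N -> timefun R) :
  0 <= d -> deg_le d M ->
  leval (geqpart 1 M) u =
    \sum_(i < N) (fdiv (a i) (u - p i) + fdiv (a i) (p i)) ->
  cdmKP_form M a p ->
  cdmKP_form (pshift u M) a (fun i => p i - u).
Proof.
move=> d0 Md Mu Mform; rewrite /cdmKP_form (geqpart_pshift u Md) Mu.
rewrite {1}Mform.
have invd i : deg_le 0 (inv_psub (p i)) by apply: deg_leW (@inv_psub_deg _ _).
have tmd i : deg_le 0 (lconst (fdiv (a i) (p i)) + lscale (a i) (inv_psub (p i))).
  move=> j j0; by rewrite laddE lconst_deg // add0r (lscale_deg (a i) (invd i)).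
have [Sd SE] := pshift_sum u tmd.
rewrite (pshiftB u (geqpart_deg 1 Md) (deg_leW d0 Sd)) SE -addrA -opprD.
congr (_ - _); rewrite (big_morph _ lconstD lconst0) -big_split.
apply: eq_bigr => i _ /=.
rewrite (@pshiftD _ 0) ?pshift_const; last 2 first.
- exact: lconst_deg.
- exact: lscale_deg.
rewrite (pshift_scale _ _ (invd i)) pshift_inv_psub addrA; congr (_ + _).
rewrite -lconstD; congr lconst; apply/funext => t.
change (a i t / p i t = a i t / (u t - p i t) + a i t / p i t + a i t / (p i t - u t)).
by rewrite -[p i t - u t]opprB invrN; ring.
Qed.

End Transformation.

Theorem theorem4p1 (R : realType) (n N : nat) (L : lseries R)
    (a p : 'I_N -> timefun R) (phi : timefun R)
    (n_ge1 : (1 <= n)%N)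
    (L_sato : sato L)
    (L_smooth : forall j, smooth (L j))
    (a_smooth : forall i, smooth (a i))
    (p_smooth : forall i, smooth (p i))
    (phi_smooth : smooth phi)
    (p_neq0 : forall i t, p i t != 0)
    (phip_neq0 : forall i t, dX phi t - p i t != 0)
    (L_form : cdmKP_form (lpow L n) a p)
    (L_flows : cdmKP_flows n (lpow L n) a p)
    (phi_flows : forall k : nat, (1 <= k)%N ->
       dT k phi = leval (Qpart n k (lpow L n)) (dX phi))
    (phi_constraint :
       leval (geqpart 1 (lpow L n)) (dX phi)
       - \sum_(i < N) (fdiv (a i) (dX phi - p i) + fdiv (a i) (p i)) = 0) :
  let tM := exp_Nad phi (lpow L n) in
  let ta := a in
  let tp := fun i : 'I_N => p i - dX phi in
  cdmKP_form tM ta tp /\ cdmKP_flows n tM ta tp.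
Proof.
move=> tM ta tp; set u := dX phi.
have tME : tM = pshift u (lpow L n) by rewrite /tM exp_Nad_pshift.
have u_smooth : smooth u by exact: smooth_partial.
have du i : pderivable i u by exact: smooth_pderivable.
have dLk i k j : pderivable i (lpow L k j).
  by apply: pderivable_lpow => // l; exact: smooth_pderivable.
have Ld k : deg_le k%:Z (lpow L k) by exact: lpow_deg.
rewrite tME; split.
  apply: (cdmKP_form_pshift _ (Ld n)) => //.
  by move/eqP: phi_constraint; rewrite subr_eq0 => /eqP.
move=> k k1; have [Mk ak pk] := L_flows k k1; have phik := phi_flows k k1.
(* The shifted [lpow L n] is the n-th power of the Sato series [pshift u L], so its fractional
   powers are the shifted powers of [L]. *)
rewrite (pshift_lpow _ _ L_sato) (Qpart_lpow _ n_ge1 (pshift_sato u L_sato)).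
rewrite -!(pshift_lpow _ _ L_sato) (geqpart_pshift u (Ld k)).
move: Mk ak pk phik; rewrite (Qpart_lpow k n_ge1 L_sato).
set Q := geqpart 1 (lpow L k); rewrite -/u => Mk ak pk phik; rewrite -phik.
have Qd : deg_le k%:Z Q by exact: geqpart_deg.
have Q0 : forall j, j < 0 -> Q j = 0 by exact: geqpart1_neg.
have dQ i j : pderivable i (Q j) by exact: pderivable_geqpart.
have dphi : pderivable 0 (dT k phi).
  by apply: smooth_pderivable; exact: smooth_partial.
(* With u = phi_X this is the equality of mixed derivatives of [phi]. *)
have uphi : dT k u = dX (dT k phi) by exact: partialC.
have Q'0 j : j < 0 -> ldp Q j = 0 by exact: (@iter_ldp_neg R 1).
have k0 : 0 <= k%:Z by [].
split.
- exact: (flow_pshift k0 Qd (Ld n) (dQ 0%N) (fun i => dLk i n) du dphi uphi Mk).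
(* The subtracted phi_(T_k) is constant in p, so the p-derivative does not see it. *)
- move=> i; rewrite ak ldpB ldp_const subr0 -(pshift_ldp u Qd).
  by rewrite /tp (leval_shift u (p i) (ldp_deg Qd) Q'0).
- move=> i; rewrite /tp.
  rewrite (levalB_const _ _ k0 (pshift_deg u Qd) (pshift_neg u Q0)).
  rewrite (leval_shift u (p i) Qd Q0).
  have dp l : pderivable l (p i) by exact: smooth_pderivable.
  (* Q(p_i) is a coefficient of a Taylor shift, hence differentiable; this permits splitting the
     X-derivative of Q(p_i) - phi_(T_k). *)
  have dQp : pderivable 0 (leval Q (p i)).
    rewrite (leval_pshift (p i) Qd Q0).
    exact: (pderivable_pshift Qd (dp 0%N) (dQ 0%N)).
  transitivity (dT k (p i) - dT k u); first exact: (partialB (dp _) (du _)).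
  by rewrite pk uphi; symmetry; exact: (partialB dQp dphi).
Qed.
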